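(* Under the standing assumptions stated in the context, the arc-search infeasible interior-point algorithm described in the context (call it Algorithm A), with appropriate choices of $\alpha_k$ and $\sigma_k$ in its Step 2, is a polynomial algorithm: it terminates after at most $$\mathcal{O}\left(n^{3/2}\max\left\{\log\frac{(x^0)^{T}s^0}{\epsilon},\ \log\frac{\|r_b^0\|}{\epsilon},\ \log\frac{\|r_c^0\|}{\epsilon}\right\}\right)$$ iterations.
   Context: Problem and notation. Consider the linear program $\min c^Tx$ subject to $Ax=b$, $x\ge 0$, with $A\in\mathbb{R}^{m\times n}$, $b\in\mathbb{R}^m$, $c\in\mathbb{R}^n$, and its dual $\max b^T\lambda$ subject to $A^T\lambda+s=c$, $s\ge 0$. $e$ is the all-ones vector, $\circ$ the componentwise product, $\|\cdot\|$ the Euclidean norm; vector inequalities are componentwise. For an iterate $(x^k,\lambda^k,s^k)$ with $x^k>0$, $s^k>0$ put $r_b^k=Ax^k-b$, $r_c^k=A^T\lambda^k+s^k-c$, $\mu_k=(x^k)^Ts^k/n$. Let $(\dot x,\dot\lambda,\dot s)$ be the unique solution of $A\dot x=r_b^k$, $A^T\dot\lambda+\dot s=r_c^k$, $s^k\circ\dot x+x^k\circ\dot s=x^k\circ s^k$, and for $\sigma\in[0,1]$ let $(\ddot x,\ddot\lambda,\ddot s)=(\ddot x(\sigma),\ddot\lambda(\sigma),\ddot s(\sigma))$ be the unique solution of $A\ddot x=0$, $A^T\ddot\lambda+\ddot s=0$, $s^k\circ\ddot x+x^k\circ\ddot s=-2\dot x\circ\dot s+\sigma\mu_ke$. For $\alpha\in[0,\pi/2]$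 set $x(\sigma,\alpha)=x^k-\dot x\sin\alpha+\ddot x(\sigma)(1-\cos\alpha)$, and define $\lambda(\sigma,\alpha)$, $s(\sigma,\alpha)$ in the same way from $\lambda^k,\dot\lambda,\ddot\lambda$ and $s^k,\dot s,\ddot s$; $\mu(\sigma,\alpha)=x(\sigma,\alpha)^Ts(\sigma,\alpha)/n$. Let $\nu_0=1$, $\nu_k=\prod_{j=0}^{k-1}(1-\sin\alpha_j)$, $\underline{x}^k=\min_i x_i^k$, $\underline{s}^k=\min_i s_i^k$, $\phi_k=\min\{\rho\underline{x}^k,\nu_k\}$, $\psi_k=\min\{\rho\underline{s}^k,\nu_k\}$. Algorithm A. Parameters $\epsilon,\sigma_{\min},\sigma_{\max},\theta,\rho\in(0,1)$, with $\sigma_{\min}<\sigma_{\max}$. Initial point: $\lambda^0=0$, $(x^0,s^0)>0$, with $x^0\circ s^0\ge\theta\mu_0e$. For $k=0,1,2,\dots$: Step 0: if $\|r_b^k\|\le\epsilon$, $\|r_c^k\|\le\epsilon$ and $\mu_k\le\epsilon$, stop. Step 1: compute $\mu_k,r_b^k,r_c^k$ and the derivatives above. Step 2: find some appropriate $\alpha_k\in(0,\pi/2]$ and $\sigma_k\in[\sigma_{\min},\sigma_{\max}]$ such that $x(\sigma_k,\alpha_k)\ge\phi_ke$, $s(\sigma_k,\alpha_k)\ge\psi_ke$, $\mu_k>\mu(\sigma_k,\alpha_k)$ and $x(\sigma_k,\alpha_k)\circ s(\sigma_k,\alpha_k)\ge\theta\mu(\sigma_k,\alpha_k)e$. Step 3: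 set $(x^{k+1},\lambda^{k+1},s^{k+1})=(x(\sigma_k,\alpha_k),\lambda(\sigma_k,\alpha_k),s(\sigma_k,\alpha_k))$, $\mu_{k+1}=\mu(\sigma_k,\alpha_k)$. Step 4: increase $k$ by one and repeat. The constant $\rho\in(0,1)$ is such that $\rho\ge 1-\sin\alpha_k$ for all $k$. Standing assumptions. (1) $A$ has full rank (full row rank). (2) The linear program has at least one optimal solution (the KKT conditions hold). (3) The components of $x^k$ and $s^k$ are bounded below away from zero for all $k$ until termination. (4) $\nu_k>0$ for all $k\ge0$. (5) There is a primal-dual point $(\bar x,\bar\lambda,\bar s)$ with $A\bar x=b$, $A^T\bar\lambda+\bar s=c$, and a constant $M$ independent of $n$ and $m$ with $\|(x^0-\bar x,s^0-\bar s)\|<M$. With $\beta_k=\min\{\underline{x}^k,\underline{s}^k\}/\nu_k$ and $\beta=\inf_k\beta_k$, the quantities $\theta,\rho,\sigma_{\min},\sigma_{\max},M$ and $\beta>0$ are treated as constants independent of $n$; the constant in $\mathcal{O}$ is independent of $n$.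
   Formalization: The requirement ρ ≥ 1 − sin α_k is dropped, since it can make Step 2 unsatisfiable (e.g. n=1, no constraints, c=1, x^0=1, s^0=0.1); instead β_k ≥ β > 0 is assumed for the iterates of the chosen steps. The bound uses max with 0 and is rounded up. *)

(* Defs.v *)
From HB Require Import structures.
From mathcomp Require Import all_boot all_order all_algebra.
From mathcomp Require Import all_classical all_reals all_analysis.

Set Implicit Arguments.
Unset Strict Implicit.
Unset Printing Implicit Defensive.

Import Order.TTheory GRing.Theory Num.Theory.

Local Open Scope classical_set_scope.
Local Open Scope ring_scope.

(* The norm that MathComp-Analysis puts on matrices is the maximum norm, hence
   this explicit Euclidean norm. *)
Definition l2norm (R : realType) (n : nat) (v : 'cV[R]_n) : R :=
  Num.sqrt (\sum_i v i ord0 ^+ 2).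

Definition dotv (R : realType) (n : nat) (u v : 'cV[R]_n) : R :=
  \sum_i u i ord0 * v i ord0.

Definition hadamard (R : realType) (n : nat) (u v : 'cV[R]_n) : 'cV[R]_n :=
  map2_mx *%R u v.

Definition vmin (R : realType) (n : nat) (v : 'cV[R]_n.+1) : R :=
  \big[Num.min/v ord0 ord0]_i v i ord0.

(* A point (x, lambda, s). Sums and scalings of points are componentwise. *)
Definition point (R : realType) (m n : nat) : Type :=
  ('cV[R]_n * 'cV[R]_m * 'cV[R]_n)%type.

Definition xc (R : realType) (m n : nat) (z : point R m n) : 'cV[R]_n := z.1.1.
Definition lc (R : realType) (m n : nat) (z : point R m n) : 'cV[R]_m := z.1.2.
Definition sc (R : realType) (m n : nat) (z : point R m n) : 'cV[R]_n := z.2.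

Definition lp_feasible (R : realType) (m n : nat) (A : 'M[R]_(m, n))
    (b : 'cV[R]_m) (x : 'cV[R]_n) : Prop :=
  A *m x = b /\ forall i, 0 <= x i ord0.

Definition lp_optimal (R : realType) (m n : nat) (A : 'M[R]_(m, n))
    (b : 'cV[R]_m) (c : 'cV[R]_n) (x : 'cV[R]_n) : Prop :=
  lp_feasible A b x /\
  forall y, lp_feasible A b y -> dotv c x <= dotv c y.

Definition res_b (R : realType) (m n : nat) (A : 'M[R]_(m, n)) (b : 'cV[R]_m)
    (z : point R m n) : 'cV[R]_m :=
  A *m xc z - b.

Definition res_c (R : realType) (m n : nat) (A : 'M[R]_(m, n)) (c : 'cV[R]_n)
    (z : point R m n) : 'cV[R]_n :=
  A^T *m lc z + sc z - c.

Definition mu (R : realType) (m n : nat) (z : point R m n) : R :=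
  dotv (xc z) (sc z) / n%:R.

Definition in_neighbourhood (R : realType) (m n : nat) (theta : R)
    (z : point R m n) : Prop :=
  forall i, theta * mu z <= hadamard (xc z) (sc z) i ord0.

Definition newton_system (R : realType) (m n : nat) (A : 'M[R]_(m, n))
    (z : point R m n) (p : 'cV[R]_m) (q w : 'cV[R]_n) (d : point R m n) : Prop :=
  [/\ A *m xc d = p,
      A^T *m lc d + sc d = q
    & hadamard (sc z) (xc d) + hadamard (xc z) (sc d) = w].

(* The solution of the system, which exists and is unique when A has full row
   rank and xc z, sc z are positive. *)
Definition newton_sol (R : realType) (m n : nat) (A : 'M[R]_(m, n))
    (z : point R m n) (p : 'cV[R]_m) (q w : 'cV[R]_n) : point R m n :=
  xget (0, 0, 0) [set d : 'cV[R]_n * 'cV[R]_m * 'cV[R]_n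
                 | newton_system A z p q w d].

Definition first_deriv (R : realType) (m n : nat) (A : 'M[R]_(m, n))
    (b : 'cV[R]_m) (c : 'cV[R]_n) (z : point R m n) : point R m n :=
  newton_sol A z (res_b A b z) (res_c A c z) (hadamard (xc z) (sc z)).

Definition second_deriv (R : realType) (m n : nat) (A : 'M[R]_(m, n))
    (b : 'cV[R]_m) (c : 'cV[R]_n) (sigma : R) (z : point R m n) : point R m n :=
  let d := first_deriv A b c z in
  newton_sol A z 0 0
    (- 2 *: hadamard (xc d) (sc d) + const_mx (sigma * mu z)).

Definition arc (R : realType) (m n : nat) (A : 'M[R]_(m, n)) (b : 'cV[R]_m)
    (c : 'cV[R]_n) (z : point R m n) (sigma alpha : R) : point R m n :=
  let d := first_deriv A b c z in
  let dd := second_deriv A b c sigma z in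
  (xc z - sin alpha *: xc d + (1 - cos alpha) *: xc dd,
   lc z - sin alpha *: lc d + (1 - cos alpha) *: lc dd,
   sc z - sin alpha *: sc d + (1 - cos alpha) *: sc dd).

Definition nu (R : realType) (alpha : nat -> R) (k : nat) : R :=
  \prod_(j < k) (1 - sin (alpha j)).

Definition stops (R : realType) (m n : nat) (A : 'M[R]_(m, n)) (b : 'cV[R]_m)
    (c : 'cV[R]_n) (eps : R) (z : point R m n) : Prop :=
  [/\ l2norm (res_b A b z) <= eps, l2norm (res_c A c z) <= eps & mu z <= eps].

(* [safeguard rho nuk x] is phi_k, and [safeguard rho nuk s] is psi_k. *)
Definition safeguard (R : realType) (n : nat) (rho nuk : R) (v : 'cV[R]_n.+1)
    : R :=
  Num.min (rho * vmin v) nuk.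

Definition step_conditions (R : realType) (m n : nat) (A : 'M[R]_(m, n.+1))
    (b : 'cV[R]_m) (c : 'cV[R]_n.+1) (theta rho nuk : R)
    (z : point R m n.+1) (sigma alpha : R) : Prop :=
  let z' := arc A b c z sigma alpha in
  [/\ forall i, safeguard rho nuk (xc z) <= xc z' i ord0,
      forall i, safeguard rho nuk (sc z) <= sc z' i ord0,
      mu z' < mu z
    & in_neighbourhood theta z'].

Definition admissible_choices (R : realType) (smin smax : R)
    (alpha sigma : nat -> R) : Prop :=
  forall k, [/\ 0 < alpha k <= pi / 2, smin <= sigma k <= smax
              & 0 < nu alpha k].

(* The iterates produced from (x0, 0, s0) by the choices alpha and sigma,
   continued past the stopping test; see [reached]. *)
Fixpoint iterates (R : realType) (m n : nat) (A : 'M[R]_(m, n)) (b : 'cV[R]_m)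
    (c : 'cV[R]_n) (x0 s0 : 'cV[R]_n) (alpha sigma : nat -> R) (k : nat)
    : point R m n :=
  if k is j.+1 then
    arc A b c (iterates A b c x0 s0 alpha sigma j) (sigma j) (alpha j)
  else (x0, 0, s0).

(* Iterate k is actually computed: no earlier iterate passes the test. *)
Definition reached (R : realType) (m n : nat) (A : 'M[R]_(m, n)) (b : 'cV[R]_m)
    (c : 'cV[R]_n) (eps : R) (z : nat -> point R m n) (k : nat) : Prop :=
  forall j, (j < k)%N -> ~ stops A b c eps (z j).

(* The quotient beta_k. A uniform positive lower bound on it is a hypothesis on
   the run. The requirement rho >= 1 - sin alpha_k is not imposed on the
   choices: its role is to ensure such a lower bound. *)
Definition beta_seq (R : realType) (m n : nat) (alpha : nat -> R)
    (z : nat -> point R m n.+1) (k : nat) : R :=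
  Num.min (vmin (xc (z k))) (vmin (sc (z k))) / nu alpha k.

Definition bounded_away (R : realType) (m n : nat) (A : 'M[R]_(m, n))
    (b : 'cV[R]_m) (c : 'cV[R]_n) (eps : R) (z : nat -> point R m n) : Prop :=
  exists2 eta : R, 0 < eta &
    forall k, reached A b c eps z k ->
    forall i, eta <= xc (z k) i ord0 /\ eta <= sc (z k) i ord0.

Definition near_solution (R : realType) (m n : nat) (A : 'M[R]_(m, n))
    (b : 'cV[R]_m) (c : 'cV[R]_n) (M : R) (x0 s0 : 'cV[R]_n) : Prop :=
  exists (xb : 'cV[R]_n) (lb : 'cV[R]_m) (sb : 'cV[R]_n),
    [/\ A *m xb = b, A^T *m lb + sb = c
      & l2norm (col_mx (x0 - xb) (s0 - sb)) < M].

(* ln is 0 at 0, so a zero residual contributes 0 instead of -oo; because of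
   the outer maximum with 0 this changes nothing. The maximum with 0 and the
   ceiling applied to the bound account for the number of iterations being a
   natural number, while the maximum of the logarithms may be negative or
   arbitrarily small and positive. *)
Definition log_gap (R : realType) (m n : nat) (A : 'M[R]_(m, n))
    (b : 'cV[R]_m) (c : 'cV[R]_n) (eps : R) (z : point R m n) : R :=
  Num.max 0
    (Num.max (ln (dotv (xc z) (sc z) / eps))
      (Num.max (ln (l2norm (res_b A b z) / eps))
               (ln (l2norm (res_c A c z) / eps)))).

(* Main.v *)
(* Constant step sizes suffice: take sin alpha = delta / n^(3/2) with delta
   independent of n, and sigma = smin.  In the norm weighted by s_i/x_i and
   x_i/s_i the two components of a Newton direction are orthogonal up to the
   residual, and the residual at step k is nu_k times the initial one; as
   beta nu_k bounds x and s from below, the first derivative has squared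
   weighted norm O(n mu) and, by the neighbourhood condition, the second one
   O(n^2 mu).  Hence the error terms in x_i s_i along the arc are
   O((1 - cos alpha) delta mu), which the centering term
   (1 - cos alpha) sigma mu absorbs, so every step satisfies the conditions of
   Step 2 and reduces mu by a factor 1 - sin alpha / 2, and the residuals by
   1 - sin alpha. *)
Require Import Defs.
From HB Require Import structures.
From mathcomp Require Import all_boot all_order all_algebra.
From mathcomp Require Import all_classical all_reals all_analysis.
From mathcomp Require Import ring lra.

Set Implicit Arguments.
Unset Strict Implicit.
Unset Printing Implicit Defensive.

Import Order.TTheory GRing.Theory Num.Theory.

Local Open Scope ring_scope.

(** * Solvability of the Newton systems *)

Definition positive (R : realType) (n : nat) (v : 'cV[R]_n) : Prop :=
  forall i, 0 < v i ord0.

Lemma vmin_le (R : realType) (n : nat) (v : 'cV[R]_n.+1) i : vmin v <= v i ord0.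
Proof. by rewrite /vmin (bigD1 i) //= ge_min lexx. Qed.

Lemma dotvE (R : realType) (n : nat) (u v : 'cV[R]_n) :
  dotv u v = (u^T *m v) ord0 ord0.
Proof. by rewrite mxE; apply: eq_bigr => i _; rewrite mxE. Qed.

(** [v] is [- A^T y], an element of the row space, which is orthogonal to the kernel. This makes the
    two parts of a homogeneous Newton direction orthogonal. *)
Lemma dotv_ker_range (R : realType) (m n : nat) (A : 'M[R]_(m, n))
    (u v : 'cV[R]_n) (y : 'cV[R]_m) :
  A *m u = 0 -> A^T *m y + v = 0 -> dotv u v = 0.
Proof.
move=> Au /eqP; rewrite addrC addr_eq0 => /eqP ->.
by rewrite dotvE mulmxN mulmxA -trmx_mul Au trmx0 mul0mx oppr0 mxE.
Qed.

(** If [v] annihilates the matrix, the quadratic form at [v] vanishes. It is the sum of the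
    nonnegative terms [d_j (v A)_j^2], so [v A = 0], and row freeness of [A] gives [v = 0]. *)
Lemma row_free_gram (R : realType) (m n : nat) (A : 'M[R]_(m, n))
    (d : 'rV[R]_n) :
  row_free A -> (forall i, 0 < d ord0 i) ->
  row_free (A *m diag_mx d *m A^T).
Proof.
move=> fA d_gt0; apply: inj_row_free => v vG0.
apply: (row_free_inj fA); rewrite mul0mx.
have : (v *m A *m diag_mx d *m (v *m A)^T) ord0 ord0 = 0.
  by move: vG0; rewrite trmx_mul !mulmxA => ->; rewrite mul0mx mxE.
rewrite mxE => sum0; apply/rowP => j; rewrite [RHS]mxE.
have F_ge0 i : 0 <= (v *m A *m diag_mx d) ord0 i * (v *m A)^T i ord0.
  rewrite mul_mx_diag mxE [_^T _ _]mxE mulrAC -expr2.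
  by rewrite mulr_ge0 ?sqr_ge0 // ltW.
have := psumr_eq0P (fun i _ => F_ge0 i) sum0 (i := j) isT.
rewrite mul_mx_diag mxE [_^T _ _]mxE mulrAC -expr2 => /eqP.
by rewrite mulf_eq0 sqrf_eq0 (gt_eqF (d_gt0 j)) orbF => /eqP.
Qed.

(** [xget] returns an element of the solution set once this set is inhabited, so it suffices to
    exhibit one solution. *)
Lemma newton_solP (R : realType) (m n : nat) (A : 'M[R]_(m, n))
    (z : Defs.point R m n) (p : 'cV[R]_m) (q w : 'cV[R]_n) :
  row_free A -> positive (xc z) -> positive (sc z) ->
  newton_system A z p q w (newton_sol A z p q w).
Proof.
move=> fA x_gt0 s_gt0.
suff [d dP] : exists d : 'cV[R]_n * 'cV[R]_m * 'cV[R]_n,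
    newton_system A z p q w d.
  exact: (@xgetPex _ (0, 0, 0) [set d | newton_system A z p q w d]%classic
           (ex_intro _ d dP)).
set d : 'rV[R]_n := \row_j (xc z j ord0 / sc z j ord0).
set wi : 'cV[R]_n := \col_j (w j ord0 / sc z j ord0).
set G := A *m diag_mx d *m A^T.
have GU : G \in unitmx.
  rewrite -row_free_unit row_free_gram // => i.
  by rewrite mxE divr_gt0.
(* Eliminating the s- and then the x-component leaves the normal equations
   with matrix A X S^-1 A^T. *)
set y := invmx G *m (p - A *m wi + A *m diag_mx d *m q).
set v := q - A^T *m y.
exists (wi - diag_mx d *m v, y, v); split => /=.
- rewrite /xc /= /v mulmxBr mulmxA mulmxBr (mulmxA _ A^T) -/G /y.
  by rewrite mulKVmx // opprB addrK addrC subrK.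
- by rewrite /lc /sc /v /= addrC subrK.
- apply/colP => i; clearbody v; rewrite /xc /sc /= mul_diag_mx !mxE.
  have xi := x_gt0 i; have si := s_gt0 i; rewrite /xc /sc in xi si *.
  by field; rewrite gt_eqF.
Qed.

(** * The energy: a squared weighted norm of a direction *)

Definition energy_at (R : realType) (n : nat) (x s u v : 'cV[R]_n) i : R :=
  s i ord0 / x i ord0 * u i ord0 ^+ 2 + x i ord0 / s i ord0 * v i ord0 ^+ 2.

(** With [D] the diagonal matrix of the square roots of [x_i / s_i], this is [|D^-1 u|^2 + |D v|^2];
    the expanded form avoids square roots. *)
Definition energy (R : realType) (n : nat) (x s u v : 'cV[R]_n) : R :=
  \sum_i energy_at x s u v i.

Lemma energy_at_ge0 (R : realType) (n : nat) (x s u v : 'cV[R]_n) i :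
  positive x -> positive s -> 0 <= energy_at x s u v i.
Proof.
move=> x_gt0 s_gt0; have xi := x_gt0 i; have si := s_gt0 i.
by rewrite addr_ge0 // mulr_ge0 ?sqr_ge0 // divr_ge0 // ltW.
Qed.

Lemma energy_at_le (R : realType) (n : nat) (x s u v : 'cV[R]_n) i :
  positive x -> positive s -> energy_at x s u v i <= energy x s u v.
Proof.
move=> x_gt0 s_gt0; rewrite /energy (bigD1 i) //= lerDl sumr_ge0 // => j _.
exact: energy_at_ge0.
Qed.

(** Squaring the i-th equation and dividing by [x_i s_i] gives the energy at [i] plus [2 u_i v_i];
    these cross terms sum to zero by orthogonality. *)
Lemma energy_newton (R : realType) (n : nat) (x s u v w : 'cV[R]_n) :
  positive x -> positive s -> dotv u v = 0 ->
  hadamard s u + hadamard x v = w ->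
  energy x s u v = \sum_i w i ord0 ^+ 2 / (x i ord0 * s i ord0).
Proof.
move=> x_gt0 s_gt0 uv0 <-.
transitivity (energy x s u v + 2 * dotv u v).
  by rewrite uv0 mulr0 addr0.
rewrite /energy /dotv mulr_sumr -big_split /=.
apply: eq_bigr => i _; rewrite !mxE /energy_at.
have xi := x_gt0 i; have si := s_gt0 i.
by field; rewrite !gt_eqF.
Qed.

(** Parallelogram law: the difference of the two sides is the energy of [(u - u', v - v')]. *)
Lemma energyD_le (R : realType) (n : nat) (x s u v u' v' : 'cV[R]_n) :
  positive x -> positive s ->
  energy x s (u + u') (v + v') <= 2 * energy x s u v + 2 * energy x s u' v'.
Proof.
move=> x_gt0 s_gt0; rewrite !mulr_sumr -big_split /=; apply: ler_sum => i _.
rewrite /energy_at !mxE -subr_ge0.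
have xi := x_gt0 i; have si := s_gt0 i.
rewrite (_ : _ - _ = s i ord0 / x i ord0 * (u i ord0 - u' i ord0) ^+ 2
                   + x i ord0 / s i ord0 * (v i ord0 - v' i ord0) ^+ 2);
  last by ring.
by rewrite addr_ge0 // mulr_ge0 ?sqr_ge0 // divr_ge0 // ltW.
Qed.

(* The weights s_i/x_i and x_i/s_i are reciprocal. *)
Lemma energy_cross (R : realType) (n : nat) (x s u v u' v' : 'cV[R]_n) i (t : R) :
  positive x -> positive s -> 0 < t ->
  `|u i ord0 * v' i ord0| <=
     (t * energy_at x s u v i + t^-1 * energy_at x s u' v' i) / 2.
Proof.
move=> x_gt0 s_gt0 t_gt0; have xi := x_gt0 i; have si := s_gt0 i.
rewrite /energy_at; move: (x i ord0) (s i ord0) (u i ord0) (v i ord0)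
  (u' i ord0) (v' i ord0) xi si => X S U V U' V' X0 S0.
have d1 : 0 < S / X by rewrite divr_gt0.
have d2 : 0 < X / S by rewrite divr_gt0.
have h1 : 0 <= t * (X / S * V ^+ 2) by rewrite pmulr_rge0 // pmulr_rge0 // sqr_ge0.
have h2 : 0 <= t^-1 * (S / X * U' ^+ 2).
  by rewrite pmulr_rge0 ?invr_gt0 // pmulr_rge0 // sqr_ge0.
(* Taking [e] to be 1 and -1 bounds the product from both sides. The proof completes a square, and
   the leftover term carries the factor [1 - e^2]. *)
have sq e : e ^+ 2 = 1 ->
    e * (U * V') <= (t * (S / X * U ^+ 2) + t^-1 * (X / S * V' ^+ 2)) / 2.
  move=> e1; rewrite -subr_ge0.
  rewrite (_ : _ - _ = t * (S / X) / 2 * (U - e * (t^-1 * (X / S)) * V') ^+ 2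
                     + t^-1 * (X / S) * V' ^+ 2 * (1 - e ^+ 2) / 2); last first.
    by field; rewrite !gt_eqF.
  by rewrite e1 subrr mulr0 mul0r addr0 mulr_ge0 ?sqr_ge0 // ltW // divr_gt0 // mulr_gt0.
have h3 := sq 1 (expr1n _ _); have h4 := sq (-1) (etrans (sqrrN 1) (expr1n _ 2)).
rewrite ler_norml !mulrDr; move: h1 h2 h3 h4.
move: (t * (S / X * _)) (t * (X / S * _)) (t^-1 * (S / X * _)).
by move: (t^-1 * (X / S * _)) (U * V') => *; apply/andP; split; lra.
Qed.

(** For [q = |u_i| / x_i] one has [q <= (t + q^2 / t) / 2], and [q^2] is at most the energy at [i]
    divided by [x_i s_i]. The free [t] is later set to the expected size of the relative change. *)
Lemma ratio_bound (R : realType) (n : nat) (x s u v : 'cV[R]_n) i (t : R) :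
  positive x -> positive s -> 0 < t ->
  `|u i ord0| <=
    x i ord0 * (t + t^-1 * (energy_at x s u v i / (x i ord0 * s i ord0))) / 2 /\
  `|v i ord0| <=
    s i ord0 * (t + t^-1 * (energy_at x s u v i / (x i ord0 * s i ord0))) / 2.
Proof.
move=> x_gt0 s_gt0 t_gt0; have xi := x_gt0 i; have si := s_gt0 i.
rewrite /energy_at; move: (x i ord0) (s i ord0) (u i ord0) (v i ord0)
  xi si => X S U V X0 S0.
have gen (a b U1 V1 : R) : 0 < a -> 0 < b ->
   `|U1| <= a * (t + t^-1 * ((b / a * U1 ^+ 2 + a / b * V1 ^+ 2) / (a * b))) / 2.
  move=> a0 b0.
  have h : 0 <= t^-1 * a * (V1 / b) ^+ 2 / 2.
    by rewrite divr_ge0 // mulr_ge0 ?sqr_ge0 // mulr_ge0 ?invr_ge0 // ltW.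
  have -> : a * (t + t^-1 * ((b / a * U1 ^+ 2 + a / b * V1 ^+ 2) / (a * b))) / 2
     = `|U1| + t^-1 * a * (t - `|U1| / a) ^+ 2 / 2 + t^-1 * a * (V1 / b) ^+ 2 / 2.
    rewrite -(real_normK (num_real U1)).
    by field; rewrite !gt_eqF.
  rewrite -addrA lerDl addr_ge0 // divr_ge0 // mulr_ge0 ?sqr_ge0 //.
  by rewrite mulr_ge0 ?invr_ge0 // ltW.
split; first exact: gen.
by have := gen S X V U S0 X0; rewrite (addrC (X / S * _)) (mulrC S X).
Qed.

(** * Energies of the first and second derivatives *)

Lemma dotv_mu (R : realType) (m n : nat) (z : Defs.point R m n.+1) :
  dotv (xc z) (sc z) = n.+1%:R * mu z.
Proof. by rewrite /mu mulrC divfK // pnatr_eq0. Qed.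

Lemma dotv_ge_term (R : realType) (n : nat) (x s : 'cV[R]_n) i :
  positive x -> positive s -> x i ord0 * s i ord0 <= dotv x s.
Proof.
move=> x_gt0 s_gt0; rewrite /dotv (bigD1 i) //= lerDl sumr_ge0 // => j _.
by rewrite mulr_ge0 // ltW.
Qed.

Lemma mu_gt0 (R : realType) (m n : nat) (z : Defs.point R m n.+1) :
  positive (xc z) -> positive (sc z) -> 0 < mu z.
Proof.
move=> x_gt0 s_gt0; rewrite /mu divr_gt0 //.
apply: lt_le_trans (dotv_ge_term ord0 x_gt0 s_gt0).
by rewrite mulr_gt0.
Qed.

Lemma l2norm_col_mx_sqr (R : realType) (n : nat) (u v : 'cV[R]_n) :
  l2norm (col_mx u v) ^+ 2 = \sum_i (u i ord0 ^+ 2 + v i ord0 ^+ 2).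
Proof.
rewrite sqr_sqrtr; last by apply: sumr_ge0 => i _; exact: sqr_ge0.
rewrite big_split_ord big_split /=; congr (_ + _); apply: eq_bigr => i _.
  by rewrite col_mxEu.
by rewrite col_mxEd.
Qed.

(** The coefficient [s / x * nuk^2] equals [x s (nuk / x)^2]. Here [x_i s_i] is at most the whole
    scalar product, and [nuk / x_i] is at most [1 / beta]; the other weight is symmetric. *)
Lemma energy_scaled_le (R : realType) (n : nat) (x s u v : 'cV[R]_n)
    (M beta nuk : R) :
  positive x -> positive s -> 0 < beta -> 0 < nuk ->
  (forall i, beta * nuk <= x i ord0) -> (forall i, beta * nuk <= s i ord0) ->
  l2norm (col_mx u v) < M ->
  energy x s (nuk *: u) (nuk *: v) <= dotv x s * (M ^+ 2 / beta ^+ 2).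
Proof.
move=> x_gt0 s_gt0 b0 nu0 bx bs uvM.
have uvM2 : \sum_i (u i ord0 ^+ 2 + v i ord0 ^+ 2) <= M ^+ 2.
  have n0 : 0 <= l2norm (col_mx u v) by exact: sqrtr_ge0.
  rewrite -l2norm_col_mx_sqr ler_pXn2r ?nnegrE //; first exact: ltW.
  exact: le_trans n0 (ltW uvM).
have b20 : 0 < beta ^+ 2 by rewrite exprn_gt0.
have D0 : 0 <= dotv x s by apply: sumr_ge0 => i _; rewrite mulr_ge0 // ltW.
rewrite mulrA mulrAC; apply: le_trans (ler_wpM2l _ uvM2); last first.
  by rewrite divr_ge0 // ltW.
rewrite mulr_sumr; apply: ler_sum => i _.
have key (a c w : R) : 0 < a -> 0 < c -> beta * nuk <= a -> a * c <= dotv x s ->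
    c / a * (nuk * w) ^+ 2 <= dotv x s / beta ^+ 2 * w ^+ 2.
  move=> a0 c0 ba ac.
  have h : nuk ^+ 2 / a <= a / beta ^+ 2.
    rewrite ler_pdivrMr // mulrAC ler_pdivlMr // -exprMn -expr2 mulrC.
    by rewrite ler_pXn2r ?nnegrE ?(ltW a0) // ltW // mulr_gt0.
  rewrite exprMn mulrA; apply: ler_wpM2r; first exact: sqr_ge0.
  apply: (le_trans (y := a * c / beta ^+ 2)); last first.
    by apply: ler_wpM2r => //; rewrite invr_ge0 ltW.
  rewrite (_ : c / a * _ = c * (nuk ^+ 2 / a)); last by ring.
  rewrite (_ : a * c / _ = c * (a / beta ^+ 2)); last by ring.
  by apply: ler_wpM2l => //; exact: ltW.
rewrite /energy_at !mxE mulrDr; apply: lerD.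
  by apply: key => //; exact: dotv_ge_term.
by apply: key => //; rewrite mulrC; exact: dotv_ge_term.
Qed.

(** The factor 8 is [2 * 3 + 2]: 3 from the square of a sum of three terms, the 2's from
    [energyD_le]. *)
Definition first_const (R : realType) (M beta : R) : R :=
  8 * (1 + M ^+ 2 / beta ^+ 2).

(** The factor 9 is 8, from the products of first derivatives, plus 1, which absorbs the centering
    term. *)
Definition second_const (R : realType) (M beta theta : R) : R :=
  9 * first_const M beta ^+ 2 / theta.

Lemma first_const_ge8 (R : realType) (M beta : R) : 8 <= first_const M beta.
Proof.
have h : 0 <= M ^+ 2 / beta ^+ 2 by rewrite divr_ge0 ?sqr_ge0.
by rewrite /first_const; lra.
Qed.

(** Subtracting [nuk] times [(dx, dl, ds)] removes both residuals, so the difference has orthogonal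
    parts and [energy_newton] applies to it. The subtracted part is controlled by
    [energy_scaled_le]. *)
Lemma first_deriv_energy (R : realType) (m n : nat) (A : 'M[R]_(m, n.+1))
    (b : 'cV[R]_m) (c : 'cV[R]_n.+1) (z : Defs.point R m n.+1)
    (dx ds : 'cV[R]_n.+1) (dl : 'cV[R]_m) (M beta nuk : R)
    (d := first_deriv A b c z) :
  row_free A -> positive (xc z) -> positive (sc z) -> 0 < beta -> 0 < nuk ->
  (forall i, beta * nuk <= xc z i ord0) ->
  (forall i, beta * nuk <= sc z i ord0) ->
  l2norm (col_mx dx ds) < M ->
  res_b A b z = nuk *: (A *m dx) ->
  res_c A c z = nuk *: (A^T *m dl + ds) ->
  energy (xc z) (sc z) (xc d) (sc d) <=
    first_const M beta * (n.+1%:R * mu z).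
Proof.
move=> fA x_gt0 s_gt0 b0 nu0 bx bs dM rb rc.
have [hA hAT hw] : newton_system A z (res_b A b z) (res_c A c z)
    (hadamard (xc z) (sc z)) d by exact: newton_solP.
set x := xc z in x_gt0 bx hw *; set s := sc z in s_gt0 bs hw *.
set u := xc d - nuk *: dx; set v := sc d - nuk *: ds.
have Au : A *m u = 0 by rewrite mulmxBr hA rb -scalemxAr subrr.
have Av : A^T *m (lc d - nuk *: dl) + v = 0.
  by rewrite mulmxBr addrACA hAT rc -scalemxAr -opprD -scalerDr subrr.
have en := energy_scaled_le x_gt0 s_gt0 b0 nu0 bx bs dM.
rewrite -dotv_mu -/x -/s.
have -> : xc d = u + nuk *: dx by rewrite subrK.
have -> : sc d = v + nuk *: ds by rewrite subrK.
apply: (le_trans (energyD_le _ _ _ _ x_gt0 s_gt0)).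
set w := hadamard s u + hadamard x v.
rewrite (energy_newton x_gt0 s_gt0 (dotv_ker_range Au Av) (erefl w)).
have wE i : w i ord0 = x i ord0 * s i ord0
    - (s i ord0 * (nuk *: dx) i ord0 + x i ord0 * (nuk *: ds) i ord0).
  have := congr1 (fun y : 'cV_n.+1 => y i ord0) hw; rewrite !mxE => <-.
  by ring.
have : \sum_i w i ord0 ^+ 2 / (x i ord0 * s i ord0) <=
    3 * dotv x s + 3 * energy x s (nuk *: dx) (nuk *: ds).
  rewrite !mulr_sumr -big_split /=; apply: ler_sum => i _.
  rewrite wE /energy_at; have xi := x_gt0 i; have si := s_gt0 i.
  move: (x i ord0) (s i ord0) ((nuk *: dx) i ord0) ((nuk *: ds) i ord0) xi si.
  move=> X S U V X0 S0; rewrite ler_pdivrMr ?mulr_gt0 //.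
  rewrite (_ : (3 * _ + _) * _ = 3 * ((X * S) ^+ 2 + (S * U) ^+ 2 + (X * V) ^+ 2));
    last by field; rewrite !gt_eqF.
  (* This is [(a - e - f)^2 <= 3 (a^2 + e^2 + f^2)], with the gap written as a sum of squares. *)
  move: (X * S) (S * U) (X * V) => a e f; rewrite -subr_ge0.
  rewrite (_ : _ - _ = (a + e) ^+ 2 + (a + f) ^+ 2 + (e - f) ^+ 2); last by ring.
  by rewrite !addr_ge0 ?sqr_ge0.
move: en; rewrite /first_const.
have -> : 8 * (1 + M ^+ 2 / beta ^+ 2) * dotv x s =
  8 * dotv x s + 8 * (dotv x s * (M ^+ 2 / beta ^+ 2)) by ring.
have : 0 <= dotv x s by apply: sumr_ge0 => i _; rewrite mulr_ge0 // ltW.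
by move: (dotv x s * _) (\sum_i _) => *; lra.
Qed.

(** The direction is homogeneous, so its energy is the sum of [w_i^2 / (x_i s_i)], whose
    denominators are at least [theta * mu z]. In each squared product of first derivatives one
    energy factor is bounded by the total and the other is summed, which avoids a further factor of
    the dimension. *)
Lemma second_deriv_energy (R : realType) (m n : nat) (A : 'M[R]_(m, n.+1))
    (b : 'cV[R]_m) (c : 'cV[R]_n.+1) (z : Defs.point R m n.+1)
    (sigma theta M beta : R) (d := first_deriv A b c z)
    (dd := second_deriv A b c sigma z) :
  row_free A -> positive (xc z) -> positive (sc z) ->
  0 < theta -> 0 <= sigma <= 1 -> in_neighbourhood theta z ->
  energy (xc z) (sc z) (xc d) (sc d) <= first_const M beta * (n.+1%:R * mu z) ->
  energy (xc z) (sc z) (xc dd) (sc dd) <=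
    second_const M beta theta * (n.+1%:R ^+ 2 * mu z).
Proof.
move=> fA x_gt0 s_gt0 th0 /andP[sig0 sig1] nb hd.
have mu0 := mu_gt0 x_gt0 s_gt0.
set w := - 2 *: hadamard (xc d) (sc d) + const_mx (sigma * mu z).
have [hA hAT hw] : newton_system A z 0 0 w dd by exact: newton_solP.
rewrite (energy_newton x_gt0 s_gt0 (dotv_ker_range hA hAT) hw).
set N : R := n.+1%:R in hd *.
have N1 : 1 <= N by rewrite ler1n.
set K := first_const M beta in hd *.
have K8 : 8 <= K by exact: first_const_ge8.
have thmu : 0 < theta * mu z by rewrite mulr_gt0.
have prod_le i : (xc d i ord0 * sc d i ord0) ^+ 2 <=
    K * (N * mu z) * energy_at (xc z) (sc z) (xc d) (sc d) i.
  have h1 := energy_at_le (xc d) (sc d) i x_gt0 s_gt0.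
  have h0 := energy_at_ge0 (xc d) (sc d) i x_gt0 s_gt0.
  have := energy_cross (xc d) (sc d) (xc d) (sc d) i x_gt0 s_gt0 ltr01.
  have h2 := le_trans h1 hd.
  rewrite -(real_normK (num_real (_ * _))) invr1 !mul1r.
  have := normr_ge0 (xc d i ord0 * sc d i ord0).
  move: (energy_at _ _ _ _ _) (K * _) `|_| h0 h2 => e k a e0 ek a0 ae.
  have {}ae : a <= e by lra.
  by rewrite expr2; apply: ler_pM => //; exact: le_trans ek.
have w_le i : w i ord0 ^+ 2 / (xc z i ord0 * sc z i ord0) <=
    (8 * (K * (N * mu z)) * energy_at (xc z) (sc z) (xc d) (sc d) i
       + 2 * mu z ^+ 2) / (theta * mu z).
  have p0 : 0 < xc z i ord0 * sc z i ord0 by rewrite mulr_gt0.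
  have := nb i; rewrite mxE => nbi.
  apply: ler_pM; rewrite ?sqr_ge0 ?invr_ge0 ?(ltW p0) ?lef_pV2 ?posrE //.
  have := prod_le i; rewrite !mxE => h.
  have h2 : (sigma * mu z) ^+ 2 <= mu z ^+ 2.
    by rewrite exprMn ler_piMl ?sqr_ge0 // expr_le1.
  have h3 := sqr_ge0 (2 * (xc d i ord0 * sc d i ord0) + sigma * mu z).
  move: h h2 h3; rewrite -(mulrA 8).
  move: (xc d i ord0 * _) (_ * energy_at _ _ _ _ _) (sigma * mu z).
  by move=> a e t *; lra.
apply: (le_trans (ler_sum _ (fun i _ => w_le i))).
rewrite -mulr_suml big_split /= -mulr_sumr sumr_const card_ord -[_ *+ n.+1]mulr_natl -/N.
rewrite ler_pdivrMr // /second_const -/K.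
have -> : 9 * K ^+ 2 / theta * (N ^+ 2 * mu z) * (theta * mu z) =
    8 * (K * (N * mu z)) ^+ 2 + (N * K * mu z) ^+ 2.
  by field; rewrite gt_eqF.
apply: lerD.
  rewrite expr2 [leRHS]mulrA; apply: ler_wpM2l hd.
  have [K0 N0] : 0 <= K /\ 0 <= N by split; lra.
  by apply: mulr_ge0 => //; apply: mulr_ge0 => //; apply: mulr_ge0 => //; exact: ltW.
rewrite (_ : (N * K * mu z) ^+ 2 = N ^+ 2 * K ^+ 2 * mu z ^+ 2); last by ring.
rewrite mulrA ler_wpM2r ?sqr_ge0 //; clearbody N K.
have h1 : N <= N ^+ 2 by rewrite expr2 ler_peMr //; lra.
have h2 : 2 <= K ^+ 2 by clear -K8; nra.
by apply: ler_pM => //; lra.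
Qed.

(** * Products and residuals along the arc *)

(* The terms of order sin alpha and (1 - cos alpha) collapse by the two Newton
   systems; the product of the first derivatives survives only with the
   coefficient sin^2 - 2 (1 - cos) = - (1 - cos)^2. *)
Lemma arc_product (R : realType) (x s dx ds ddx dds S c w : R) :
  s * dx + x * ds = x * s -> s * ddx + x * dds = - 2 * (dx * ds) + w ->
  S ^+ 2 = 2 * c - c ^+ 2 ->
  (x - S * dx + c * ddx) * (s - S * ds + c * dds) =
  (1 - S) * (x * s) + c * w -
    c * (c * (dx * ds) + S * (dx * dds + ddx * ds) - c * (ddx * dds)).
Proof.
move=> h1 h2 h3.
transitivity (x * s - S * (s * dx + x * ds) + c * (s * ddx + x * dds)
   + S ^+ 2 * (dx * ds) - S * c * (dx * dds + ddx * ds) + c ^+ 2 * (ddx * dds)); first by ring.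
by rewrite h1 h2 h3; ring.
Qed.

(** The first derivative reproduces the residuals and the second has none, so only the [sin alpha]
    term changes them. *)
Lemma residuals_arc (R : realType) (m n : nat) (A : 'M[R]_(m, n))
    (b : 'cV[R]_m) (c : 'cV[R]_n) (z : Defs.point R m n) (sigma alpha : R)
    (z' := Defs.arc A b c z sigma alpha) :
  row_free A -> positive (xc z) -> positive (sc z) ->
  res_b A b z' = (1 - sin alpha) *: res_b A b z /\
  res_c A c z' = (1 - sin alpha) *: res_c A c z.
Proof.
move=> fA x_gt0 s_gt0.
have [hA hAT _] := newton_solP (res_b A b z) (res_c A c z)
  (hadamard (xc z) (sc z)) fA x_gt0 s_gt0.
rewrite -/(first_deriv A b c z) in hA hAT.
set d := first_deriv A b c z in hA hAT.
have [hA' hAT' _] := newton_solP 0 0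
  (- 2 *: hadamard (xc d) (sc d) + const_mx (sigma * mu z)) fA x_gt0 s_gt0.
rewrite -/(second_deriv A b c sigma z) in hA' hAT'.
rewrite /z' /Defs.arc -/d; set dd := second_deriv A b c sigma z in hA' hAT' *.
clearbody dd d; split.
  rewrite /res_b {1}/xc /= mulmxDr mulmxBr -!scalemxAr hA hA' scaler0 addr0.
  by rewrite scalerBl scale1r addrAC.
have -> : (1 - sin alpha) *: res_c A c z =
    res_c A c z - sin alpha *: (A^T *m lc d + sc d).
  by rewrite hAT scalerBl scale1r.
rewrite /res_c {1}/lc {2}/sc /=.
rewrite mulmxDr mulmxBr -!scalemxAr scalerDr.
have -> : A^T *m lc dd = - sc dd by apply/eqP; rewrite -addr_eq0 hAT'.
rewrite scalerN.
set t := sin alpha; set e := 1 - cos alpha.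
move: (A^T *m lc z) (sc z) (t *: (A^T *m lc d)) (t *: sc d) (e *: sc dd).
move=> a1 a2 a3 a4 a5; apply/matrixP => i j; rewrite !mxE.
by ring.
Qed.

(** * One step from a point of the neighbourhood *)

Section OneStep.

Variables (R : realType) (m n : nat) (A : 'M[R]_(m, n.+1)) (b : 'cV[R]_m)
  (c : 'cV[R]_n.+1) (z : Defs.point R m n.+1) (sigma alpha theta rho r K1 K2 delta : R).
Let d := first_deriv A b c z.
Let dd := second_deriv A b c sigma z.
Let z' := Defs.arc A b c z sigma alpha.

Hypotheses (fA : row_free A) (x_gt0 : positive (xc z)) (s_gt0 : positive (sc z))
  (htheta : 0 < theta < 1) (hsigma : 0 < sigma <= 1)
  (nb : in_neighbourhood theta z).
(** [r] is the square root of the dimension, so the exponent 3/2 becomes the natural power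
    [r ^+ 3]. *)
Hypotheses (hr : r ^+ 2 = n.+1%:R) (r1 : 1 <= r)
  (hS : sin alpha * r ^+ 3 = delta) (cos0 : 0 <= cos alpha).
Hypotheses (K1_ge0 : 0 <= K1) (K2_ge0 : 0 <= K2)
  (en1 : energy (xc z) (sc z) (xc d) (sc d) <= K1 * (n.+1%:R * mu z))
  (en2 : energy (xc z) (sc z) (xc dd) (sc dd) <= K2 * (n.+1%:R ^+ 2 * mu z)).
Hypotheses (delta0 : 0 < delta) (delta4 : delta <= 1 / 4)
  (deltaK : 4 * (delta * (K1 + K2)) <= sigma * (1 - theta))
  (deltaR : delta * (1 + (K1 + K2) / theta) <= 1 - rho).

Let r_gt0 : 0 < r. Proof. exact: lt_le_trans r1. Qed.

Let mu0 : 0 < mu z. Proof. exact: mu_gt0. Qed.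

Let S0 : 0 < sin alpha.
Proof. by rewrite -(pmulr_lgt0 _ (exprn_gt0 3 r_gt0)) hS. Qed.

Let expr_r_le i j : (i <= j)%N -> r ^+ i <= r ^+ j.
Proof. by move=> ij; rewrite ler_weXn2l. Qed.

Let Sr1 : sin alpha * r <= delta.
Proof. by rewrite -hS ler_wpM2l ?(ltW S0) // -{1}(expr1 r) expr_r_le. Qed.

Let S_le : sin alpha <= delta.
Proof. by apply: le_trans Sr1; rewrite ler_peMr // ltW. Qed.

Let cc := 1 - cos alpha.

Let cos_le : cos alpha <= 1. Proof. exact: cos_le1. Qed.

Let Scc : sin alpha ^+ 2 = 2 * cc - cc ^+ 2.
Proof. by rewrite /cc; have := cos2Dsin2 alpha; nra. Qed.

Let cc0 : 0 <= cc. Proof. by rewrite subr_ge0. Qed.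

(** The difference is [cc * cos alpha]. *)
Let cc_le : cc <= sin alpha ^+ 2.
Proof. by move: cos0 cos_le; rewrite Scc /cc => *; nra. Qed.

(** [cc] is of second order in [sin alpha], and [sin alpha ^+ 2 * r ^+ 6] is [delta ^+ 2]. *)
Let ccr4 : cc * r ^+ 4 <= delta.
Proof.
apply: (le_trans (ler_wpM2r (exprn_ge0 4 (ltW r_gt0)) cc_le)).
apply: (le_trans (y := sin alpha ^+ 2 * r ^+ 6)).
  by rewrite ler_wpM2l ?sqr_ge0 ?expr_r_le.
have -> : sin alpha ^+ 2 * r ^+ 6 = delta ^+ 2 by rewrite -hS; ring.
by rewrite expr2 ler_piMl ?(ltW delta0) // (le_trans delta4) //; lra.
Qed.

Let ccr2 : cc * r ^+ 2 <= delta.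
Proof. by apply: le_trans ccr4; rewrite ler_wpM2l ?expr_r_le. Qed.

Let en1_at i : energy_at (xc z) (sc z) (xc d) (sc d) i <= K1 * r ^+ 2 * mu z.
Proof.
by apply: (le_trans (energy_at_le _ _ _ x_gt0 s_gt0)); rewrite -mulrA hr.
Qed.

Let en2_at i : energy_at (xc z) (sc z) (xc dd) (sc dd) i <= K2 * r ^+ 4 * mu z.
Proof.
apply: (le_trans (energy_at_le _ _ _ x_gt0 s_gt0)).
by rewrite -mulrA (exprM r 2 2) hr.
Qed.

(** The bracket that [arc_product] multiplies by [- cc]. *)
Let rem i := cc * (xc d i ord0 * sc d i ord0)
  + sin alpha * (xc d i ord0 * sc dd i ord0 + xc dd i ord0 * sc d i ord0)
  - cc * (xc dd i ord0 * sc dd i ord0).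

(** The mixed products dictate the exponent 3/2. The energies have orders [r^2] and [r^4];
    [energy_cross] weighted by [r] balances them at [r^3], which [sin alpha] compensates down to
    [delta]. *)
Let rem_le i : `|rem i| <= 2 * (delta * (K1 + K2)) * mu z.
Proof.
have e1 := en1_at i; have e2 := en2_at i.
have c11 : `|xc d i ord0 * sc d i ord0| <= K1 * r ^+ 2 * mu z.
  have := energy_cross (xc d) (sc d) (xc d) (sc d) i x_gt0 s_gt0 ltr01.
  rewrite invr1 !mul1r; move: e1.
  by move: (energy_at _ _ _ _ _) (_ * mu z) `|_| => *; lra.
have c22 : `|xc dd i ord0 * sc dd i ord0| <= K2 * r ^+ 4 * mu z.
  have := energy_cross (xc dd) (sc dd) (xc dd) (sc dd) i x_gt0 s_gt0 ltr01.
  rewrite invr1 !mul1r; move: e2.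
  by move: (energy_at _ _ _ _ _) (_ * mu z) `|_| => *; lra.
have f1 : r * energy_at (xc z) (sc z) (xc d) (sc d) i <= K1 * r ^+ 3 * mu z.
  apply: (le_trans (ler_wpM2l (ltW r_gt0) e1)).
  by rewrite le_eqVlt; apply/orP; left; apply/eqP; ring.
have f2 : r^-1 * energy_at (xc z) (sc z) (xc dd) (sc dd) i
    <= K2 * r ^+ 3 * mu z.
  have ri0 : 0 <= r^-1 by rewrite invr_ge0 ltW.
  apply: (le_trans (ler_wpM2l ri0 e2)).
  by rewrite le_eqVlt; apply/orP; left; apply/eqP; field; rewrite gt_eqF.
have c12 : `|xc d i ord0 * sc dd i ord0| <= (K1 + K2) * r ^+ 3 * mu z / 2.
  apply: (le_trans (energy_cross _ (sc d) (xc dd) _ i x_gt0 s_gt0 r_gt0)).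
  by move: f1 f2; move: (r * energy_at _ _ _ _ _) (r^-1 * _) => *; lra.
have c21 : `|xc dd i ord0 * sc d i ord0| <= (K1 + K2) * r ^+ 3 * mu z / 2.
  have ri0 : 0 < r^-1 by rewrite invr_gt0.
  apply: (le_trans (energy_cross _ (sc dd) (xc d) _ i x_gt0 s_gt0 ri0)).
  rewrite invrK.
  by move: f1 f2; move: (r * energy_at _ _ _ _ _) (r^-1 * _) => *; lra.
rewrite /rem; apply: (le_trans (ler_normB _ _)).
apply: (le_trans (lerD (ler_normD _ _) (lexx _))).
rewrite !normrM -/cc.
rewrite (ger0_norm cc0) (gtr0_norm S0) -!normrM.
have n12 := le_trans (ler_normD (xc d i ord0 * sc dd i ord0)
  (xc dd i ord0 * sc d i ord0)) (lerD c12 c21).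
apply: (le_trans (lerD (lerD (ler_wpM2l cc0 c11) (ler_wpM2l (ltW S0) n12))
  (ler_wpM2l cc0 c22))).
have -> : cc * (K1 * r ^+ 2 * mu z) + sin alpha *
    ((K1 + K2) * r ^+ 3 * mu z / 2 + (K1 + K2) * r ^+ 3 * mu z / 2)
    + cc * (K2 * r ^+ 4 * mu z) =
    (K1 * (cc * r ^+ 2) + (K1 + K2) * (sin alpha * r ^+ 3)
       + K2 * (cc * r ^+ 4)) * mu z by field.
rewrite ler_wpM2r ?(ltW mu0) // hS.
have k1 := ler_wpM2l K1_ge0 ccr2; have k2 := ler_wpM2l K2_ge0 ccr4.
move: k1 k2; move: (K1 * (cc * _)) (K2 * (cc * _)) => k1 k2.
by rewrite !(mulrC delta) => *; lra.
Qed.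

Let prod' i : xc z' i ord0 * sc z' i ord0 =
  (1 - sin alpha) * (xc z i ord0 * sc z i ord0) + cc * (sigma * mu z) - cc * rem i.
Proof.
have [_ _ hw] := newton_solP (res_b A b z) (res_c A c z)
  (hadamard (xc z) (sc z)) fA x_gt0 s_gt0.
have [_ _ hw'] := newton_solP 0 0
  (- 2 *: hadamard (xc d) (sc d) + const_mx (sigma * mu z)) fA x_gt0 s_gt0.
have := congr1 (fun y : 'cV_n.+1 => y i ord0) hw.
have := congr1 (fun y : 'cV_n.+1 => y i ord0) hw'.
rewrite -/(first_deriv A b c z) -/(second_deriv A b c sigma z) -/d -/dd.
rewrite /z' /Defs.arc -/d -/dd /xc /sc /= => h2 h1.
move: h1 h2; rewrite !mxE => h1 h2.
exact: arc_product.
Qed.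

(** By [deltaK] the remainder is at most the fraction [(1 - theta) / 2] of the centering term. *)
Let prod'_bounds i :
  (1 - sin alpha) * (xc z i ord0 * sc z i ord0) + cc * (sigma * mu z)
    - cc * (sigma * (1 - theta) / 2 * mu z) <= xc z' i ord0 * sc z' i ord0
  <= (1 - sin alpha) * (xc z i ord0 * sc z i ord0) + cc * (sigma * mu z)
    + cc * (sigma * (1 - theta) / 2 * mu z).
Proof.
have rl : `|rem i| <= sigma * (1 - theta) / 2 * mu z.
  have dK : 2 * (delta * (K1 + K2)) <= sigma * (1 - theta) / 2 by move: deltaK => ?; lra.
  by apply: (le_trans (rem_le i)); rewrite ler_wpM2r ?(ltW mu0).
move: rl; rewrite ler_norml => /andP[l1 l2].
have := ler_wpM2l cc0 l1; have := ler_wpM2l cc0 l2.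
rewrite prod' mulrN => h2 h1; rewrite lerD2l lerN2 h2 /=.
by rewrite lerD2l lerNl.
Qed.

Let mu'_le : mu z' <= (1 - sin alpha) * mu z + cc * (sigma * mu z)
    + cc * (sigma * (1 - theta) / 2 * mu z).
Proof.
rewrite {1}/mu ler_pdivrMr //.
apply: (le_trans (ler_sum _ (fun i _ => proj2 (andP (prod'_bounds i))))).
rewrite !big_split /= -mulr_sumr -/(dotv (xc z) (sc z)) dotv_mu.
have sumc (k : R) : \sum_(i < n.+1) k = k * n.+1%:R.
  by rewrite sumr_const card_ord mulr_natr.
rewrite !sumc.
by rewrite le_eqVlt; apply/orP; left; apply/eqP; ring.
Qed.

(** The growth terms are at most [2 sin^2 alpha], hence at most [sin alpha / 2] because
    [sin alpha <= delta <= 1 / 4]. *)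
Lemma arc_mu_le : mu z' <= (1 - sin alpha / 2) * mu z.
Proof.
apply: (le_trans mu'_le).
rewrite (_ : _ + _ =
  (1 - sin alpha + cc * (sigma + sigma * (1 - theta) / 2)) * mu z); last by field.
rewrite ler_wpM2r ?(ltW mu0) //.
have [/andP[t0 t1] /andP[s0 s1]] := (htheta, hsigma).
have h : cc * (sigma + sigma * (1 - theta) / 2) <= sin alpha ^+ 2 * 2.
  have st : sigma * theta < sigma by rewrite gtr_pMr.
  have st0 : 0 < sigma * theta by rewrite mulr_gt0.
  by apply: ler_pM => //; lra.
have h' : sin alpha ^+ 2 <= sin alpha * (1 / 4).
  by rewrite expr2 ler_wpM2l ?(ltW S0) // (le_trans S_le).
by move: h h'; move: (cc * _) (sin alpha ^+ 2) (sin alpha) => *; lra.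
Qed.

(** Subtracting [theta] times the upper bound on the new [mu] from the lower bound on a product
    leaves the old slack, scaled, plus [cc * sigma * mu z * (1 - theta)^2 / 2]. *)
Lemma arc_neighbourhood : in_neighbourhood theta z'.
Proof.
move=> i; rewrite mxE.
have [/andP[t0 t1] /andP[s0 s1]] := (htheta, hsigma).
have /andP[lo _] := prod'_bounds i; apply: le_trans lo.
apply: (le_trans (ler_wpM2l (ltW t0) mu'_le)).
have := nb i; rewrite mxE => nbi.
have S1 : 0 <= 1 - sin alpha by move: S_le delta4 => *; lra.
have h := ler_wpM2l S1 nbi.
have h' : 0 <= cc * (sigma * mu z) * (1 - theta) ^+ 2.
  by rewrite mulr_ge0 ?sqr_ge0 // mulr_ge0 // ltW // mulr_gt0.
move: h; rewrite -subr_ge0 => h; rewrite -subr_ge0.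
rewrite [leRHS](_ : _ = ((1 - sin alpha) * (xc z i ord0 * sc z i ord0)
    - (1 - sin alpha) * (theta * mu z))
    + cc * (sigma * mu z) * (1 - theta) ^+ 2 / 2); last by field.
by rewrite addr_ge0 // divr_ge0.
Qed.

Let ratio_le (x dx ddx : R) : 0 < x ->
  `|dx| <= x * (r * (1 + K1 / theta)) / 2 ->
  `|ddx| <= x * (r ^+ 2 * (1 + K2 / theta)) / 2 ->
  rho * x <= x - sin alpha * dx + cc * ddx.
Proof.
move=> x0 h1 h2; have /andP[t0 t1] := htheta.
have g1 : sin alpha * dx <= x * (delta * (1 + K1 / theta)) / 2.
  apply: (le_trans (ler_norm _)); rewrite normrM gtr0_norm //.
  apply: (le_trans (ler_wpM2l (ltW S0) h1)).
  rewrite [leLHS](_ : _ = x * (sin alpha * r * (1 + K1 / theta)) / 2); last by ring.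
  rewrite ler_wpM2r // ler_wpM2l ?(ltW x0) // ler_wpM2r //.
  by rewrite addr_ge0 // divr_ge0 // ltW.
have g2 : - (cc * ddx) <= x * (delta * (1 + K2 / theta)) / 2.
  apply: (le_trans (ler_norm _)); rewrite normrN normrM ger0_norm //.
  apply: (le_trans (ler_wpM2l cc0 h2)).
  rewrite [leLHS](_ : _ = x * (cc * r ^+ 2 * (1 + K2 / theta)) / 2); last by ring.
  rewrite ler_wpM2r // ler_wpM2l ?(ltW x0) // ler_wpM2r //.
  by rewrite addr_ge0 // divr_ge0 // ltW.
have := ler_wpM2l (ltW x0) deltaR.
have : 0 <= x * (delta * ((K1 + K2) / theta)).
  rewrite mulr_ge0 ?(ltW x0) // mulr_ge0 ?(ltW delta0) //.
  by rewrite divr_ge0 ?addr_ge0 // ltW.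
by move: g1 g2; rewrite mulrDl !mulrDr; lra.
Qed.

(** This serves the safeguards of Step 2. [ratio_bound] with [t] equal to [r] and [r^2] gives
    relative sizes of order [r] and [r^2] for the two derivatives, while [sin alpha * r] and
    [cc * r^2] are at most [delta]. *)
Lemma arc_ratio i :
  rho * xc z i ord0 <= xc z' i ord0 /\ rho * sc z i ord0 <= sc z' i ord0.
Proof.
have /andP[t0 t1] := htheta.
have p0 : 0 < xc z i ord0 * sc z i ord0 by rewrite mulr_gt0.
have := nb i; rewrite mxE => nbi.
have quot (e k : R) : 0 <= k -> e <= k * mu z ->
    e / (xc z i ord0 * sc z i ord0) <= k / theta.
  move=> k0 ek; rewrite ler_pdivrMr //; apply: (le_trans ek).
  rewrite -mulrA ler_wpM2l // mulrC ler_pdivlMr //.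
  by rewrite mulrC.
have ri0 : 0 < r^-1 by rewrite invr_gt0.
have q1 := ler_wpM2l (ltW ri0)
  (quot _ _ (mulr_ge0 K1_ge0 (exprn_ge0 2 (ltW r_gt0))) (en1_at i)).
have r20 : 0 < r ^+ 2 by rewrite exprn_gt0.
have r20' : 0 <= (r ^+ 2)^-1 by rewrite invr_ge0 ltW.
have q2 := ler_wpM2l r20'
  (quot _ _ (mulr_ge0 K2_ge0 (exprn_ge0 4 (ltW r_gt0))) (en2_at i)).
have [b1 b1'] := ratio_bound (xc d) (sc d) i x_gt0 s_gt0 r_gt0.
have [b2 b2'] := ratio_bound (xc dd) (sc dd) i x_gt0 s_gt0 r20.
have Q1 : r + r^-1 * (K1 * r ^+ 2 / theta) = r * (1 + K1 / theta).
  by field; rewrite !gt_eqF.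
have Q2 : r ^+ 2 + (r ^+ 2)^-1 * (K2 * r ^+ 4 / theta) =
    r ^+ 2 * (1 + K2 / theta) by field; rewrite !gt_eqF.
have fin (y w e t : R) : 0 < y -> e <= t -> `|w| <= y * e / 2 ->
    `|w| <= y * t / 2.
  move=> y0 et h; apply: (le_trans h).
  by rewrite ler_wpM2r // ler_wpM2l // ltW.
rewrite /z' /Defs.arc -/d -/dd /xc /sc /= !mxE; split; apply: ratio_le => //.
- by apply: fin b1 => //; rewrite -Q1 lerD2l.
- by apply: fin b2 => //; rewrite -Q2 lerD2l.
- by apply: fin b1' => //; rewrite -Q1 lerD2l.
- by apply: fin b2' => //; rewrite -Q2 lerD2l.
Qed.

End OneStep.

Lemma arc_step (R : realType) (m n : nat) (A : 'M[R]_(m, n.+1))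
    (b : 'cV[R]_m) (c : 'cV[R]_n.+1) (z : Defs.point R m n.+1)
    (dx ds : 'cV[R]_n.+1) (dl : 'cV[R]_m)
    (theta rho sigma M beta nuk alpha r delta : R)
    (K := first_const M beta + second_const M beta theta)
    (z' := Defs.arc A b c z sigma alpha) :
  row_free A -> positive (xc z) -> positive (sc z) ->
  0 < theta < 1 -> 0 < rho -> 0 < sigma <= 1 -> 0 < beta -> 0 < nuk ->
  in_neighbourhood theta z ->
  (forall i, beta * nuk <= xc z i ord0) ->
  (forall i, beta * nuk <= sc z i ord0) ->
  l2norm (col_mx dx ds) < M ->
  res_b A b z = nuk *: (A *m dx) ->
  res_c A c z = nuk *: (A^T *m dl + ds) ->
  r ^+ 2 = n.+1%:R -> 1 <= r -> sin alpha * r ^+ 3 = delta ->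
  0 <= cos alpha -> 0 < delta -> delta <= 1 / 4 ->
  4 * (delta * K) <= sigma * (1 - theta) ->
  delta * (1 + K / theta) <= 1 - rho ->
  step_conditions A b c theta rho nuk z sigma alpha /\
  mu z' <= (1 - sin alpha / 2) * mu z.
Proof.
move=> fA x_gt0 s_gt0 th rho0 sig b0 nu0 nb bx bs dM rb rc hr r1 hS cos0.
move=> delta0 delta4 dK dR; have [/andP[th0 _] /andP[sig0 sig1]] := (th, sig).
have sig01 : 0 <= sigma <= 1 by rewrite sig1 ltW.
have en1 := first_deriv_energy fA x_gt0 s_gt0 b0 nu0 bx bs dM rb rc.
have en2 := second_deriv_energy fA x_gt0 s_gt0 th0 sig01 nb en1.
have K1_ge0 : 0 <= first_const M beta.
  by apply: le_trans (first_const_ge8 M beta).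
have K2_ge0 : 0 <= second_const M beta theta.
  by rewrite divr_ge0 ?(ltW th0) // mulr_ge0 ?sqr_ge0.
have mu_le := arc_mu_le fA x_gt0 s_gt0 th sig hr r1 hS cos0 K1_ge0 K2_ge0
  en1 en2 delta0 delta4 dK.
have nb' := arc_neighbourhood fA x_gt0 s_gt0 th sig nb hr r1 hS cos0 K1_ge0
  K2_ge0 en1 en2 delta0 delta4 dK.
have ratio := arc_ratio x_gt0 s_gt0 th nb hr r1 hS cos0 K1_ge0
  K2_ge0 en1 en2 delta0 delta4 dR.
have S0 : 0 < sin alpha.
  by rewrite -(pmulr_lgt0 _ (exprn_gt0 3 (lt_le_trans ltr01 r1))) hS.
split=> //; split=> // [i|i|].
(* The first entry of the minimum in the safeguard is enough. *)
- apply: le_trans (ratio i).1; rewrite ge_min; apply/orP; left.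
  by rewrite ler_wpM2l ?vmin_le // ltW.
- apply: le_trans (ratio i).2; rewrite ge_min; apply/orP; left.
  by rewrite ler_wpM2l ?vmin_le // ltW.
- apply: (le_lt_trans mu_le); rewrite gtr_pMl ?mu_gt0 //.
  by rewrite ltrBlDr ltrDl divr_gt0.
Qed.

(** * Decay along the whole run and termination *)

Lemma l2normZ (R : realType) (n : nat) (a : R) (v : 'cV[R]_n) :
  0 <= a -> l2norm (a *: v) = a * l2norm v.
Proof.
move=> a0; rewrite /l2norm.
under eq_bigr do rewrite mxE exprMn.
by rewrite -mulr_sumr sqrtrM ?sqr_ge0 // sqrtr_sqr ger0_norm.
Qed.

(** [(1 - t)^k] is at most [exp(- t k)], hence at most [eps / g]. *)
Lemma geometric_decay (R : realType) (t g eps gap : R) (k : nat) :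
  0 <= t <= 1 -> 0 <= g -> 0 < eps -> ln (g / eps) <= gap ->
  gap <= t * k%:R -> (1 - t) ^+ k * g <= eps.
Proof.
(* At [g = 0] the logarithm has its default value and carries no information; the claim is then
   immediate. *)
move=> /andP[t0 t1] g0 eps0 lng gapk; have [->|gn0] := eqVneq g 0.
  by rewrite mulr0 ltW.
have {gn0} g_gt0 : 0 < g by rewrite lt_def gn0.
rewrite -ler_pdivlMr //; apply: (le_trans (y := expR (- (t * k%:R)))).
  rewrite -mulNr mulrC expRM_natl.
  by apply: lerXn2r; rewrite ?nnegrE ?expR_ge0 ?subr_ge0 // expR_ge1Dx.
rewrite -[leRHS]invrK invf_div -[in leRHS](lnK (x := g / eps)); last first.
  by rewrite posrE divr_gt0.
by rewrite -expRN ler_expR lerN2 (le_trans lng).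
Qed.

Section Run.

Variables (R : realType) (theta rho sigma M beta r delta alpha : R).
Let K := first_const M beta + second_const M beta theta.
Hypotheses (htheta : 0 < theta < 1) (hrho : 0 < rho) (hsigma : 0 < sigma <= 1)
  (hbeta : 0 < beta) (r1 : 1 <= r) (hS : sin alpha * r ^+ 3 = delta)
  (cos0 : 0 <= cos alpha) (delta0 : 0 < delta) (delta4 : delta <= 1 / 4)
  (deltaK : 4 * (delta * K) <= sigma * (1 - theta))
  (deltaR : delta * (1 + K / theta) <= 1 - rho).
Variables (m n : nat) (A : 'M[R]_(m, n.+1)) (b : 'cV[R]_m) (c : 'cV[R]_n.+1)
  (eps : R) (x0 s0 : 'cV[R]_n.+1).
Let z := iterates A b c x0 s0 (fun=> alpha) (fun=> sigma).
Let nuk := nu (fun=> alpha).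
Hypotheses (hr : r ^+ 2 = n.+1%:R) (eps0 : 0 < eps) (fA : row_free A)
  (x0_gt0 : positive x0) (s0_gt0 : positive s0)
  (nb0 : in_neighbourhood theta (z 0%N)) (near : near_solution A b c M x0 s0)
  (betaP : forall k, reached A b c eps z k -> beta <= beta_seq (fun=> alpha) z k).

Let S0 : 0 < sin alpha.
Proof. by rewrite -(pmulr_lgt0 _ (exprn_gt0 3 (lt_le_trans ltr01 r1))) hS. Qed.

Let S1 : sin alpha < 1.
Proof.
apply: (@le_lt_trans _ _ delta); last by move: delta4 => ?; lra.
by rewrite -hS ler_peMr ?(ltW S0) // exprn_ege1.
Qed.

Let nukE k : nuk k = (1 - sin alpha) ^+ k.
Proof. by rewrite /nuk /nu prodr_const card_ord. Qed.

Let nuk_gt0 k : 0 < nuk k.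
Proof. by rewrite nukE exprn_gt0 // subr_gt0. Qed.

Let reached_ge k : reached A b c eps z k ->
  forall i, beta * nuk k <= xc (z k) i ord0 /\ beta * nuk k <= sc (z k) i ord0.
Proof.
move=> /betaP; rewrite /beta_seq ler_pdivlMr // le_min => /andP[hx hs] i.
by split; [apply: (le_trans hx) | apply: (le_trans hs)]; exact: vmin_le.
Qed.

(** Positivity comes from the lower bound [beta], which is assumed at reached iterates only; hence
    the premise [reached] throughout the induction. *)
Let reached_gt0 k : reached A b c eps z k ->
  positive (xc (z k)) /\ positive (sc (z k)).
Proof.
move=> /reached_ge h; split=> i; have [hx hs] := h i.
  by apply: lt_le_trans hx; rewrite mulr_gt0.
by apply: lt_le_trans hs; rewrite mulr_gt0.
Qed.

(** The residuals are tracked by equalities, since [arc_step] needs them as [nuk k] times the image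
    of one fixed displacement. *)
Let invariant k := [/\ in_neighbourhood theta (z k),
  mu (z k) <= (1 - sin alpha / 2) ^+ k * mu (z 0%N),
  res_b A b (z k) = nuk k *: res_b A b (z 0%N) &
  res_c A c (z k) = nuk k *: res_c A c (z 0%N)].

Let run_step k : reached A b c eps z k -> invariant k ->
  step_conditions A b c theta rho (nuk k) (z k) sigma alpha /\ invariant k.+1.
Proof.
move=> rk [nbk muk rbk rck]; have [xk sk] := reached_gt0 rk.
have bk := reached_ge rk.
have [xb [lb [sb [Axb Asb dM]]]] := near.
(* The displacement is the initial point minus [(xb, lb, sb)]; its middle part is [- lb] because
   [lambda] starts at 0. *)
have rb0 : res_b A b (z 0%N) = A *m (x0 - xb).
  by rewrite mulmxBr Axb.
have rc0 : res_c A c (z 0%N) = A^T *m (- lb) + (s0 - sb).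
  by rewrite /res_c /lc /= mulmx0 add0r -Asb mulmxN opprD addrCA addrA.
have rbk' := rbk; have rck' := rck; rewrite rb0 in rbk'; rewrite rc0 in rck'.
have [sC mu_le] := arc_step fA xk sk htheta hrho hsigma hbeta (nuk_gt0 k) nbk
  (fun i => (bk i).1) (fun i => (bk i).2) dM rbk' rck' hr r1 hS cos0 delta0
  delta4 deltaK deltaR.
have [rb rc] := residuals_arc b c sigma alpha fA xk sk.
split=> //; split; first by case: sC.
- apply: (le_trans mu_le); rewrite exprS -mulrA ler_wpM2l //.
  by rewrite subr_ge0 ler_pdivrMr // mul1r (le_trans (ltW S1)) // ler1n.
- by rewrite [z _]/= rb rbk scalerA !nukE exprS.
- by rewrite [z _]/= rc rck scalerA !nukE exprS.
Qed.

Lemma run_invariant k : reached A b c eps z k -> invariant k.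
Proof.
elim: k => [_|k IH rk].
  by split; rewrite ?expr0 ?mul1r // nukE expr0 scale1r.
have rk' : reached A b c eps z k by move=> j jk; apply: rk; exact: ltnW.
by case: (run_step rk' (IH rk')).
Qed.

Lemma run_step_conditions k : reached A b c eps z k ->
  step_conditions A b c theta rho (nuk k) (z k) sigma alpha.
Proof. by move=> rk; case: (run_step rk (run_invariant rk)). Qed.

(** The slower rate [1 - sin alpha / 2] of [mu] also dominates the residuals, so one decay estimate
    serves all three tests. *)
Lemma run_stops k :
  log_gap A b c eps (z 0%N) <= sin alpha / 2 * k%:R ->
  reached A b c eps z k -> stops A b c eps (z k).
Proof.
move=> gapk rk; have [_ muk rbk rck] := run_invariant rk.
have t01 : 0 <= sin alpha / 2 <= 1.
  by rewrite divr_ge0 ?(ltW S0) //= ler_pdivrMr // mul1r (le_trans (ltW S1)) // ler1n.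
have nuk_le : nuk k <= (1 - sin alpha / 2) ^+ k.
  rewrite nukE; apply: lerXn2r; rewrite ?nnegrE ?subr_ge0 ?(ltW S1) //.
    by case/andP: t01.
  by rewrite lerD2l lerN2 ler_pdivrMr // ler_peMr ?(ltW S0) // ler1n.
have decay g : 0 <= g -> ln (g / eps) <= log_gap A b c eps (z 0%N) ->
    (1 - sin alpha / 2) ^+ k * g <= eps.
  by move=> g0 lng; apply: geometric_decay gapk.
have pw0 : 0 <= (1 - sin alpha / 2) ^+ k.
  by rewrite exprn_ge0 // subr_ge0; case/andP: t01.
have sq0 p (v : 'cV[R]_p) : 0 <= l2norm v by exact: sqrtr_ge0.
split.
- rewrite rbk l2normZ ?(ltW (nuk_gt0 k)) //.
  apply: (le_trans (ler_wpM2r (sq0 _ _) nuk_le)); apply: decay => //.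
  by rewrite /log_gap !le_max lexx !orbT.
- rewrite rck l2normZ ?(ltW (nuk_gt0 k)) //.
  apply: (le_trans (ler_wpM2r (sq0 _ _) nuk_le)); apply: decay => //.
  by rewrite /log_gap !le_max lexx !orbT.
- apply: (le_trans muk); have mu0 := mu_gt0 (z := z 0%N) x0_gt0 s0_gt0.
  have mu_le : mu (z 0%N) <= dotv (xc (z 0%N)) (sc (z 0%N)).
    by rewrite dotv_mu ler_peMl ?ler1n // ltW.
  apply: (le_trans (ler_wpM2l pw0 mu_le)); apply: decay.
    exact: le_trans (ltW mu0) mu_le.
  by rewrite /log_gap !le_max lexx !orbT.
Qed.

(** Either iterate [k] is reached and stops, or an earlier one passes the test; [K0] is the least
    such index. *)
Lemma run_terminates k :
  log_gap A b c eps (z 0%N) <= sin alpha / 2 * k%:R ->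
  exists K0 : nat, [/\ stops A b c eps (z K0), (K0 <= k)%N &
    forall j, (j < K0)%N -> ~ stops A b c eps (z j) /\
      step_conditions A b c theta rho (nuk j) (z j) sigma alpha].
Proof.
move=> gapk.
have exK : exists j, `[< stops A b c eps (z j) >] && (j <= k)%N.
  have [rk|/existsNP[j /not_implyP[jk /contrapT sj]]] :=
    pselect (reached A b c eps z k).
    by exists k; rewrite leqnn andbT; apply/asboolP; exact: run_stops.
  by exists j; rewrite (ltnW jk) andbT; apply/asboolP.
case: (ex_minnP exK) => K0 /andP[/asboolP sK0 K0k] minK0.
have nostop j : (j < K0)%N -> ~ stops A b c eps (z j).
  move=> jK0 /asboolP sj; have := minK0 j; rewrite sj /=.
  by rewrite (ltnW (leq_trans jK0 K0k)) leqNgt jK0 => /(_ isT).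
exists K0; split=> // j jK0; split; first exact: nostop.
by apply: run_step_conditions => i ij; apply: nostop; exact: ltn_trans jK0.
Qed.

End Run.

(** * Choice of the constants, and the iteration count *)

Theorem theorem4p2 (R : realType) (theta rho smin smax M beta : R)
    (htheta : 0 < theta < 1) (hrho : 0 < rho < 1)
    (hsmin : 0 < smin) (hsigma : smin < smax) (hsmax : smax < 1)
    (hM : 0 < M) (hbeta : 0 < beta) :
  exists2 C : R, 0 < C &
  forall n : nat,
  exists alpha sigma : nat -> R,
    admissible_choices smin smax alpha sigma /\
    forall (m : nat) (A : 'M[R]_(m, n.+1)) (b : 'cV[R]_m) (c : 'cV[R]_n.+1)
           (eps : R) (x0 s0 : 'cV[R]_n.+1),
    let z := iterates A b c x0 s0 alpha sigma in
    0 < eps < 1 ->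
    row_free A ->
    (exists x, lp_optimal A b c x) ->
    (forall i, 0 < x0 i ord0 /\ 0 < s0 i ord0) ->
    in_neighbourhood theta (z 0%N) ->
    near_solution A b c M x0 s0 ->
    bounded_away A b c eps z ->
    (forall k, reached A b c eps z k -> beta <= beta_seq alpha z k) ->
    exists K : nat,
      [/\ stops A b c eps (z K),
          forall k, (k < K)%N ->
            ~ stops A b c eps (z k) /\
            step_conditions A b c theta rho (nu alpha k) (z k)
              (sigma k) (alpha k)
        & K%:Z <= Num.ceil (C * (n.+1%:R `^ (3 / 2)) *
                            log_gap A b c eps (z 0%N))].
Proof.
have [/andP[t0 t1] /andP[rho0 rho1]] := (htheta, hrho).
have s1 : smin <= 1 by exact: ltW (lt_trans hsigma hsmax).
set K := first_const M beta + second_const M beta theta.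
have K0 : 0 < K.
  have K1 : 0 < first_const M beta.
    by apply: lt_le_trans (first_const_ge8 M beta).
  by rewrite /K addr_gt0 // divr_gt0 // mulr_gt0 // exprn_gt0.
have KR0 : 0 < 1 + K / theta by rewrite addr_gt0 // divr_gt0.
(* The three entries are exactly what [delta4], [deltaK] and [deltaR] require; none depends on the
   dimension. *)
pose delta := Num.min (1 / 4)
  (Num.min (smin * (1 - theta) / (4 * K)) ((1 - rho) / (1 + K / theta))).
have delta0 : 0 < delta.
  by rewrite !lt_min !divr_gt0 ?mulr_gt0 ?subr_gt0.
have delta4 : delta <= 1 / 4 by rewrite ge_min lexx.
have deltaK : 4 * (delta * K) <= smin * (1 - theta).
  rewrite mulrCA -ler_pdivlMr ?mulr_gt0 //.
  by rewrite /delta !ge_min lexx !orbT.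
have deltaR : delta * (1 + K / theta) <= 1 - rho.
  by rewrite -ler_pdivlMr // /delta !ge_min lexx !orbT.
exists (2 / delta); first by rewrite divr_gt0.
move=> n.
set r : R := Num.sqrt n.+1%:R.
have hr : r ^+ 2 = n.+1%:R by rewrite sqr_sqrtr.
have r1 : 1 <= r by rewrite -[leLHS]sqrtr1 ler_sqrt // ler1n.
have r0 : 0 < r by exact: lt_le_trans r1.
have r30 : 0 < r ^+ 3 by rewrite exprn_gt0.
have hpow : n.+1%:R `^ (3 / 2) = r ^+ 3.
  by rewrite mulrC powRrM powR12_sqrt // powR_mulrn // sqrtr_ge0.
pose S := delta / r ^+ 3.
have S0 : 0 < S by rewrite divr_gt0.
have S1 : S < 1.
  rewrite ltr_pdivrMr // mul1r (@lt_le_trans _ _ 1) ?exprn_ege1 //.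
  by apply: (le_lt_trans delta4); lra.
have SN1 : -1 <= S <= 1 by apply/andP; split; lra.
have sinS : sin (asin S) = S by apply: asinK; rewrite in_itv.
have asin_pi2 : asin S <= pi / 2 by exact: asin_lepi2.
have asin0 : 0 < asin S.
  (* Were [asin S <= 0], the sine of [- asin S] would be nonnegative and [S] could not be
     positive. *)
  rewrite ltNge; apply/negP => aS; have := S0; rewrite -sinS ltNge => /negP; apply.
  rewrite -oppr_ge0 -sinN sin_ge0_pi // oppr_ge0 aS /=.
  have := asin_geNpi2 SN1; have := pi_ge0 R; lra.
exists (fun=> asin S), (fun=> smin); split.
  move=> k; split; first by rewrite asin0.
    by rewrite lexx ltW.
  by rewrite /nu prodr_gt0 // => j _; rewrite sinS subr_gt0.
move=> m A b c eps x0 s0 z /andP[eps0 _] fA _ pos nb near _ betaP.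
set g := log_gap A b c eps (z 0%N).
set B := 2 / delta * n.+1%:R `^ (3 / 2) * g.
have g0 : 0 <= g by rewrite le_max lexx.
have B0 : 0 <= B by rewrite /B hpow mulr_ge0 // ltW // mulr_gt0 // divr_gt0.
have cB0 : 0 <= Num.ceil B by rewrite ceil_ge0 (lt_le_trans _ B0) // oppr_lt0.
have sig : 0 < smin <= 1 by rewrite hsmin.
have hS : sin (asin S) * r ^+ 3 = delta by rewrite sinS divfK // gt_eqF.
have cos0 : 0 <= cos (asin S).
  by apply: cos_ge0_pihalf; rewrite asin_geNpi2 // asin_lepi2.
(* [C = 2 / delta] makes [sin alpha / 2 * B] equal to [g]; rounding [B] up only helps. *)
have gapB : g <= sin (asin S) / 2 * `|Num.ceil B|%N%:R.
  have := ceil_ge B; rewrite -(gez0_abs cB0) absz_nat => hB.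
  apply: (le_trans (y := sin (asin S) / 2 * B)).
    rewrite sinS /S /B hpow le_eqVlt; apply/orP; left; apply/eqP.
    by field; rewrite !gt_eqF.
  by rewrite ler_wpM2l // divr_ge0 // sinS ltW.
have [K1 [sK1 K1B step]] := run_terminates htheta rho0 sig hbeta r1 hS cos0
  delta0 delta4 deltaK deltaR hr eps0 fA (fun i => (pos i).1)
  (fun i => (pos i).2) nb near betaP gapB.
exists K1; split=> //.
by rewrite -(gez0_abs cB0) lez_nat.
Qed.
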